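(* Let $J\subseteq\mathbb{R}$ be a bounded interval, let $c\ge 1$, and let $\varphi\in A_1(J,c)$. Then $\varphi\in L^p(J)$ for every $p\in\left[1,\frac{c}{c-1}\right)$. Moreover, for every subinterval $I$ of $J$ and every $p\in\left[1,\frac{c}{c-1}\right)$, $$\frac{1}{|I|}\int_{I}\varphi^p(x)\,dx\le \frac{1}{c^{p-1}(c+p-pc)}\left(\frac{1}{|I|}\int_{I}\varphi(x)\,dx\right)^p .$$ Additionally, this inequality is sharp: for each such $c$ and $p$, the constant $\frac{1}{c^{p-1}(c+p-pc)}$ on the right-hand side cannot be replaced by any smaller constant so that the inequality still holds for all $\varphi\in A_1(J,c)$ and all subintervals $I$ of $J$.
   Context: Intervals are non-degenerate (of positive length), $|\cdot|$ is Lebesgue measure on $\mathbb{R}$, and $\mathbb{R}^+$ denotes the positive reals. For an interval $J\subseteq\mathbb{R}$, the class $A_1(J)$ is the set of all measurable functions $\varphi:J\to\mathbb{R}^+$ for which there is a constant $c\ge 1$ such that $$\frac{1}{|I|}\int_I\varphi(x)\,dx\le c\cdot \operatorname{ess\,inf}_{I}(\varphi)\quad\text{for every subinterval } I \text{ of } J$$ (with $I=J$ allowed). The least such constant $c$ is called the $A_1$-constant of $\varphi$ and is denoted $[\varphi]_1$. One writes $\varphi\in A_1(J,c)$ if $\varphi\in A_1(J)$ and $[\varphi]_1=c$. For $c=1$, $\frac{c}{c-1}$ is interpreted as $+\infty$. *)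

(* Defs.v *)
From mathcomp Require Import all_boot all_order all_algebra.
From mathcomp Require Import all_classical all_reals all_analysis.
From mathcomp Require Import ess_sup_inf hoelder.

Set Implicit Arguments.
Unset Strict Implicit.
Unset Printing Implicit Defensive.

Import Order.TTheory GRing.Theory Num.Theory.
Import numFieldNormedType.Exports.

Local Open Scope classical_set_scope.
Local Open Scope ring_scope.

(* The measurable structure of [R] itself is the Borel one; [lebesgue_line R]
   has the same carrier, but its measurable sets are all the Lebesgue
   measurable sets, on which the completed Lebesgue measure lives. *)
Notation lebesgue_line R := (caratheodory_type (wlength (@idfun R))^*%mu).

Definition leb (R : realType) : {measure set (lebesgue_line R) -> \bar R} :=
  @completed_lebesgue_measure R.

Definition nondegenerate_interval (R : realType) (I : set R) : Prop :=
  is_interval I /\ (0 < leb R I)%E.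

(* The value may be +oo. *)
Definition average (R : realType) (I : set R) (f : R -> R) : \bar R :=
  ((leb R I)^-1 * \int[leb R]_(x in I) (f x)%:E)%E.

(* The library's essential infimum is taken over the whole space: outside of
   [I] the function is replaced by +oo, which does not affect the infimum. *)
Definition ess_inf_on (R : realType) (I : set R) (f : R -> R) : \bar R :=
  ess_inf (leb R) (patch (fun=> +oo%E) I (EFin \o f)).

Definition A1_bound (R : realType) (J : set R) (phi : R -> R) (c : R) : Prop :=
  1 <= c /\
  forall I : set R, nondegenerate_interval I -> I `<=` J ->
    (average I phi <= c%:E * ess_inf_on I phi)%E.

(* Functions on [J] are total functions whose values outside [J] are
   irrelevant. *)
Definition A1 (R : realType) (J : set R) (phi : R -> R) : Prop :=
  [/\ measurable_fun (J : set (lebesgue_line R)) (phi : lebesgue_line R -> R),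
      (forall x, J x -> 0 < phi x)
    & exists c, A1_bound J phi c].

Definition is_A1_constant (R : realType) (J : set R) (phi : R -> R) (c : R) :
    Prop :=
  A1_bound J phi c /\ (forall c', A1_bound J phi c' -> c <= c').

Definition A1_with_constant (R : realType) (J : set R) (c : R)
    (phi : R -> R) : Prop :=
  A1 J phi /\ is_A1_constant J phi c.

(* [f] belongs to L^p(J), as membership of its extension by zero in L^p of the
   line. *)
Definition Lp_on (R : realType) (J : set R) (p : R) (f : R -> R) : Prop :=
  ((f \_ J)%FUN : lebesgue_line R -> R) \in Lfun (leb R) p%:E.

Definition critical_exponent (R : realType) (c : R) : \bar R :=
  if c == 1 then +oo%E else (c / (c - 1))%:E.

Definition admissible_exponent (R : realType) (c p : R) : Prop :=
  1 <= p /\ (p%:E < critical_exponent c)%E.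

Definition sharp_constant (R : realType) (c p : R) : R :=
  1 / (c `^ (p - 1) * (c + p - p * c)).

(* Main.v *)
Require Import Defs.
From mathcomp Require Import all_boot all_order all_algebra.
From mathcomp Require Import all_classical all_reals all_analysis.
From mathcomp Require Import measurable_realfun ess_sup_inf hoelder.
From mathcomp Require Import ring lra.

(** Fix an interval I on which phi satisfies the A1 inequality with constant c,
    and let A be the average of phi over I.

    The geometric heart is a bound on the superlevel sets
    E = { x in I | t < phi x }: for every t >= A / c,
      integral of phi over E <= c t |E|.
    On an interval K that is not almost contained in E the essential infimum of
    phi is at most t, so that the A1 inequality reads
    (integral of phi over K) <= c t |K|.  Covering E by the components of an
    open set of nearly the same measure would therefore give the bound, were it
    not for the components almost contained in E.  Such a component can be
    pushed slightly beyond one of its endpoints, provided that E is not almost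
    everything near that endpoint; to guarantee this, the open set is made to
    contain all the points near which E is almost everything, which costs only a
    null set ([locally_null], [integral_interval_extend],
    [integral_le_covering], [integral_superlevel_le]).  This is the substitute
    for passing to the decreasing rearrangement of phi, of which the bound is
    the Hardy-type inequality.

    The rest is one-dimensional calculus.  The A1 inequality on I itself says
    that phi >= a := A / c almost everywhere.  Multiplying the superlevel bound
    by (p - 1) t ^ (p - 2) and integrating over t > a, Tonelli's theorem
    ([layer_cake]) turns the left-hand side into the integral of
    phi (phi ^ (p - 1) - a ^ (p - 1)) and the right-hand side into
    c (p - 1) / p times the integral of phi ^ p - a ^ p.  The integral of
    phi ^ p can then be absorbed on the left because c (p - 1) < p, which is the
    condition on the exponent, and the value of a gives exactly the constant
    1 / (c ^ (p - 1) (c + p - p c)).  The absorption needs finite integrals, so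
    it is done for min(phi, b) ([truncated_power_integral]), and then b tends to
    infinity ([power_integral_le]).

    For sharpness, every inequality above is an equality for the power
    (x - a) ^ (1 / c - 1), where a now denotes the left endpoint of J: its averages
    over the intervals starting at a are exactly c times its value at the right
    endpoint ([power_weight_A1_with_constant],
    [power_weight_average_power]). *)

Set Implicit Arguments.
Unset Strict Implicit.
Unset Printing Implicit Defensive.
Import Order.TTheory GRing.Theory Num.Theory.
Import numFieldNormedType.Exports.

Local Open Scope classical_set_scope.
Local Open Scope ring_scope.

(** * Intervals and integrals on the line with its Lebesgue sigma-algebra *)

Section line.
Context {R : realType}.
Implicit Types (A I E : set R).

Lemma leb_lebesgue A : leb R A = lebesgue_measure A.
Proof. by []. Qed.

Lemma measurable_line A : measurable A ->
  measurable (A : set (lebesgue_line R)).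
Proof. exact: sub_caratheodory. Qed.

Lemma interval_measurable_line I : is_interval I ->
  measurable (I : set (lebesgue_line R)).
Proof. by move=> iI; apply: measurable_line; exact: is_interval_measurable. Qed.

Lemma leb_ball (x r : R) : 0 < r -> leb R (ball x r) = (r *+ 2)%:E.
Proof. by move=> r0; rewrite leb_lebesgue lebesgue_measure_ball// ltW. Qed.

Lemma bounded_leb_lty I : bounded_set I -> (leb R I < +oo)%E.
Proof.
move=> [M [_ /(_ (M + 1))]]; rewrite ltrDl ltr01 => /(_ isT) IM.
have sub : I `<=` `[- (M + 1), M + 1]%classic.
  by move=> x /IM /=; rewrite in_itv/= ler_norml.
apply: (@le_lt_trans _ _ (lebesgue_measure `[- (M + 1), M + 1]%classic)).
  exact: le_outer_measure.
by rewrite lebesgue_measure_itv/=; case: ifP => _; rewrite ltry.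
Qed.

End line.

Lemma is_intervalI (R : realType) (A B : set R) :
  is_interval A -> is_interval B -> is_interval (A `&` B).
Proof.
move=> iA iB x y [Ax Bx] [Ay By] z xzy.
by split; [exact: iA Ax Ay _ xzy|exact: iB Bx By _ xzy].
Qed.

Lemma interval_setU (R : realType) (A B : set R) :
  is_interval A -> is_interval B -> A `&` B !=set0 -> is_interval (A `|` B).
Proof.
move=> /connected_intervalP cA /connected_intervalP cB AB.
by apply/connected_intervalP; exact: connectedU.
Qed.

Lemma nondegenerate_itv (R : realType) (I : set R) :
  nondegenerate_interval I -> (leb R I < +oo)%E ->
  exists (u v : R) (b0 b1 : bool),
    u < v /\ I = [set` Interval (BSide b0 u) (BSide b1 v)].
Proof.
move=> [/is_intervalP ->]; rewrite leb_lebesgue lebesgue_measure_itv.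
case: (Rhull I) => [[b0 u|[]] [b1 v|[]]] //=.
all: rewrite ?ltry ?ltNyr ?ltxx//.
case: ifPn => [uv _ _|_]; last by rewrite ltxx.
by exists u, v, b0, b1; split => //; rewrite -lte_fin.
Qed.

Lemma itv_sub_endpoints (R : realType) (u v x y : R) :
  u < v -> `]u, v[ `<=` `[x, y] -> x <= u /\ v <= y.
Proof.
move=> uv sub.
have mid t : u < t -> t < v -> x <= t <= y.
  by move=> ut tv; have /sub : `]u, v[%classic t by apply/andP.
split; rewrite leNgt; apply/negP => h.
  have [xv|vx] := leP x v.
    by have [||] := andP (mid ((u + x) / 2) _ _); lra.
  by have [||] := andP (mid ((u + v) / 2) _ _); lra.
have [uy|yu] := leP u y.
  by have [||] := andP (mid ((y + v) / 2) _ _); lra.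
by have [||] := andP (mid ((u + v) / 2) _ _); lra.
Qed.

Lemma leb_itv (R : realType) (u v : R) (b0 b1 : bool) : u < v ->
  leb R [set` Interval (BSide b0 u) (BSide b1 v)] = (v - u)%:E.
Proof. by move=> uv; rewrite leb_lebesgue lebesgue_measure_itv/= lte_fin uv. Qed.

Lemma measurable_id_line (R : realType) :
  measurable_fun [set: lebesgue_line R] (@id R : lebesgue_line R -> measurableTypeR R).
Proof. by move=> _ Y mY; rewrite setTI; exact: measurable_line. Qed.

(** The completed measure is transported to the Borel one along the identity,
    so that integrals of Borel functions can be computed in the Borel setting,
    where the fundamental theorem of calculus is stated. *)
Lemma integral_leb (R : realType) (D : set R) (f : R -> \bar R) :
  measurable D -> measurable_fun D f -> (forall x, D x -> (0 <= f x)%E) ->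
  (\int[leb R]_(x in D) f x = \int[lebesgue_measure]_(x in D) f x)%E.
Proof.
move=> mD mf f0.
pose nu : {measure set (measurableTypeR R) -> \bar R} :=
  pushforward (leb R) (@id R : lebesgue_line R -> measurableTypeR R).
transitivity (\int[nu (@measurable_id_line R)]_(x in D) f x)%E.
  apply/esym/(@ge0_integral_pushforward _ _ _ _ R _ (@measurable_id_line R)) => //.
  by move=> x /set_mem /f0.
exact: eq_measure_integral.
Qed.


(** * Bounding an integral through the intervals that leave a set *)

(** Lindelof's argument: the points of A near which A is null are covered by
    countably many null traces of A on intervals with rational endpoints. *)
Lemma locally_null (R : realType) (A : set R) :
  measurable (A : set (lebesgue_line R)) ->
  exists N : set R, [/\ measurable (N : set (lebesgue_line R)), leb R N = 0%E &
    forall x r, A x -> 0 < r -> leb R (A `&` ball x r) = 0%E -> N x].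
Proof.
move=> mA.
pose C (n : nat) : set R := if unpickle n is Some pq then
   A `&` `]ratr (pq : rat * rat).1, ratr pq.2[ else set0.
pose F n := if leb R (C n) == 0%E then C n else set0.
have mC n : measurable (C n : set (lebesgue_line R)).
  rewrite /C; case: unpickle => [pq|]; last exact: measurable0.
  by apply: measurableI => //; apply: measurable_line.
have mF n : measurable (F n : set (lebesgue_line R)).
  by rewrite /F; case: ifP => // _; exact: measurable0.
have F0 n : leb R (F n) = 0%E by rewrite /F; case: ifP => [/eqP//|_]; exact: measure0.
exists (\bigcup_n F n); split.
- by apply: bigcupT_measurable => n; exact: mF.
- apply/negligibleP; first by apply: bigcupT_measurable => n; exact: mF.
  by apply: negligible_bigcup => n; apply/negligibleP; [exact: mF|exact: F0].
move=> x r Ax r0 mA0.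
have [p] : exists p : rat, ratr p \in `]x - r, x[ by apply: rat_in_itvoo; rewrite gtrBl.
rewrite in_itv/= => /andP[xp px].
have [q] : exists q : rat, ratr q \in `]x, x + r[ by apply: rat_in_itvoo; rewrite ltrDl.
rewrite in_itv/= => /andP[xq qx].
(* The code of the pair is generalized so that nothing tries to compute it. *)
move: (pickleK (p, q)); move: (pickle (p, q)) => n nK.
exists n => //.
have CE : C n = A `&` `]ratr p, ratr q[%classic by rewrite /C nK.
have Cx : C n x by rewrite CE; split => //=; rewrite in_itv/= px xq.
suff C0 : leb R (C n) = 0%E by rewrite /F C0 eqxx.
apply/negligibleP; first exact: mC.
apply: negligibleS (_ : (leb R).-negligible (A `&` ball x r)); last first.
  by apply/negligibleP => //; apply: measurableI => //;
    apply: measurable_line; exact: measurable_ball.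
rewrite CE => y [Ay /=]; rewrite in_itv/= => /andP[py yq]; split => //.
by rewrite /ball/= ltr_norml; apply/andP; split; lra.
Qed.


(** When E fills the interval almost everywhere, the hypothesis on f does not
    apply to it, but it applies to its union with any ball around a, which is
    still an interval; the radius of the ball then tends to 0. *)
Lemma integral_interval_extend (R : realType) (I J E : set R)
    (f : lebesgue_line R -> \bar R) (k a : R) :
  is_interval I -> is_interval J -> 0 <= k ->
  measurable (E : set (lebesgue_line R)) ->
  measurable_fun (I : set (lebesgue_line R)) f ->
  (forall x, I x -> 0 <= f x)%E ->
  (forall K : set R, is_interval K -> K `<=` I -> (0 < leb R (K `\` E))%E ->
     (\int[leb R]_(x in K) f x <= k%:E * leb R K)%E) ->
  I a -> closure J a ->
  (forall r : R, 0 < r -> (0 < leb R ((I `\` E) `&` ball a r))%E) ->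
  (\int[leb R]_(x in I `&` J) f x <= k%:E * leb R (I `&` J))%E.
Proof.
move=> iI iJ k0 mE mf f0 H Ia cJa aE.
have mI := interval_measurable_line iI.
have mJ := interval_measurable_line iJ.
apply/lee_addgt0Pr => e e0.
(* The ball contributes k * (2 r), which has to stay below e. *)
pose r := e / (k *+ 2 + 1).
have k21 : 0 < k *+ 2 + 1 by rewrite ltr_wpDl// mulrn_wge0.
have r0 : 0 < r by rewrite divr_gt0.
have mB : measurable (ball a r : set (lebesgue_line R)).
  by apply: measurable_line; exact: measurable_ball.
have iB : is_interval (ball a r : set R).
  by rewrite ball_itv; exact: interval_is_interval.
pose K := I `&` (J `|` ball a r).
have mK : measurable (K : set (lebesgue_line R)).
  by apply: measurableI => //; exact: measurableU.
have KI : K `<=` I by move=> x [].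
have iK : is_interval K.
  apply: is_intervalI => //; apply: interval_setU => //.
  have [x [Jx Bx]] := cJa _ (nbhsx_ballx a r r0).
  by exists x.
have mKE : measurable (K `\` E : set (lebesgue_line R)) by exact: measurableD.
have KE : (0 < leb R (K `\` E))%E.
  apply: (lt_le_trans (aE _ r0)); apply: le_measure; rewrite ?inE//.
    by apply: measurableI => //; exact: measurableD.
  by move=> x [[Ix Ex] Bx]; split => //; split => //; right.
have fK : measurable_fun (K : set (lebesgue_line R)) f.
  exact: measurable_funS mf.
apply: (@le_trans _ _ (\int[leb R]_(x in K) f x)%E).
  apply: ge0_subset_integral => //.
  - exact: measurableI.
  - by move=> x /KI /f0.
  - by move=> x [Ix Jx]; split => //; left.
apply: (le_trans (H _ iK KI KE)).
apply: (@le_trans _ _ (k%:E * (leb R (I `&` J) + leb R (ball a r)))%E).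
  apply: lee_wpmul2l; first by rewrite lee_fin.
  apply: (@le_trans _ _ (leb R ((I `&` J) `|` ball a r))).
    apply: le_measure; rewrite ?inE//.
      by apply: measurableU => //; exact: measurableI.
    by move=> x [Ix [Jx|Bx]]; [left|right].
  by apply: measureU2 => //; exact: measurableI.
rewrite ge0_muleDr//; apply: leeD => //.
rewrite leb_ball// -EFinM lee_fin.
have -> : k * (r *+ 2) = e * (k *+ 2) / (k *+ 2 + 1) by rewrite /r; ring.
by rewrite ler_pdivrMr// ler_pM2l//; lra.
Qed.

(** Take an open G that contains E and the null set N of [locally_null] and
    exceeds E by little.  For a component J of G in which E is almost
    everything, connectedness of I yields a in I that is adherent to J but not
    in J; two components being disjoint, a is not in G, hence not in N, and so
    J can be extended past a by [integral_interval_extend]. *)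
Lemma integral_le_covering (R : realType) (I E : set R)
    (f : lebesgue_line R -> \bar R) (k : R) :
  is_interval I -> 0 <= k ->
  measurable (E : set (lebesgue_line R)) -> E `<=` I ->
  (0 < leb R (I `\` E))%E ->
  measurable_fun (I : set (lebesgue_line R)) f ->
  (forall x, I x -> 0 <= f x)%E ->
  (forall K : set R, is_interval K -> K `<=` I -> (0 < leb R (K `\` E))%E ->
     (\int[leb R]_(x in K) f x <= k%:E * leb R K)%E) ->
  (\int[leb R]_(x in E) f x <= k%:E * leb R E)%E.
Proof.
move=> iI k0 mE EI IE0 mf f0 H.
have mI := interval_measurable_line iI.
have mIE : measurable (I `\` E : set (lebesgue_line R)) by exact: measurableD.
have [N [mN N0 NP]] := locally_null mIE.
have EN0 : leb R (E `|` N) = leb R E.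
  apply/eqP; rewrite eq_le; apply/andP; split.
    by rewrite -[leRHS]adde0 -N0; exact: measureU2.
  by apply: le_measure; rewrite ?inE//; exact: measurableU.
suff HG (e : R) : 0 < e -> (\int[leb R]_(x in E) f x <= k%:E * (leb R E + e%:E))%E.
  apply/lee_addgt0Pr => e e0.
  have k1 : 0 < k + 1 by rewrite ltr_wpDl.
  apply: (le_trans (HG (e / (k + 1)) _)); first by rewrite divr_gt0.
  have ek0 : 0 <= e / (k + 1) by rewrite divr_ge0// ltW.
  rewrite ge0_muleDr//; apply: leeD => //.
  by rewrite -EFinM lee_fin mulrA ler_pdivrMr// mulrC ler_pM2l//; lra.
move=> e0.
have [G [oG ENG Ge]] := outer_measure_open_le (E `|` N) e0.
pose J := open_disjoint_itv oG.
have GJ : G = \bigcup_i J i := open_disjoint_itv_bigcup oG.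
have mJ i : measurable (I `&` J i : set (lebesgue_line R)).
  apply: measurableI => //; apply: interval_measurable_line.
  exact: open_disjoint_itv_is_interval.
have mG : measurable (I `&` G : set (lebesgue_line R)).
  by apply: measurableI => //; apply: measurable_line; exact: open_measurable.
have IG : I `&` G = \bigcup_i (I `&` J i) by rewrite GJ setI_bigcupr.
have tJ : trivIset [set: nat] (fun i => I `&` J i).
  apply: trivIset_setIl; exact: open_disjoint_itv_trivIset.
have fG : measurable_fun (I `&` G : set (lebesgue_line R)) f.
  exact: measurable_funS mf.
apply: (@le_trans _ _ (\int[leb R]_(x in I `&` G) f x)%E).
  apply: ge0_subset_integral => //.
  - by move=> x [/f0].
  - by move=> x Ex; split; [exact: EI|apply: ENG; left].
apply: (@le_trans _ _ (k%:E * leb R (I `&` G))%E); last first.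
  apply: lee_wpmul2l; first by rewrite lee_fin.
  rewrite -EN0; apply: le_trans Ge.
  by apply: le_outer_measure => x [].
rewrite IG ge0_integral_bigcup//; last 2 first.
  by rewrite -IG.
  by move=> x [i _ [/f0]].
rewrite measure_bigcup//= (@eq_eseriesl _ (fun i => i \in [set: nat]) xpredT); last first.
  by move=> i; apply/mem_set.
rewrite -nneseriesZl//.
apply: lee_nneseries => [i _ _|i _].
  by apply: integral_ge0 => x [/f0].
have iJ : is_interval (J i) by exact: open_disjoint_itv_is_interval.
have oJ n : open (J n) by exact: open_disjoint_itv_open.
have [JE|] := ltP 0%E (leb R ((I `&` J i) `\` E)).
  by apply: H => //; exact: is_intervalI.
move=> JE.
have [->|/set0P[x [Ix Jx]]] := eqVneq (I `&` J i) set0.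
  by rewrite integral_set0 measure0 mule0.
(* Otherwise J would be relatively closed and open in I, and E would be
   almost all of I. *)
have [a [Ia cJa Ja]] : exists a, [/\ I a, closure (J i) a & ~ J i a].
  apply: contrapT => nex.
  suff IJ : I `&` J i = I by move: JE; rewrite IJ leNgt IE0.
  apply: (connected_intervalP I).2 => //.
  - by exists x.
  - by exists (J i).
  - exists (closure (J i)); first exact: closed_closure.
    apply/seteqP; split => y [Iy Jy]; split => //; first exact: subset_closure.
    by apply: contrapT => nJ; apply: nex; exists y.
apply: (integral_interval_extend (E := E) (a := a)) => //.
move=> r r0; rewrite lt_neqAle measure_ge0 andbT eq_sym; apply/eqP => aE.
have : ~ G a.
  rewrite GJ => -[n _ Jna].
  have [y [Jy Jny]] := cJa (J n) (open_nbhs_nbhs (conj (oJ n) Jna)).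
  have /(_ i n) := @open_disjoint_itv_trivIset _ _ oG.
  move=> /(_ Logic.I Logic.I) E1.
  have ni : i = n by apply: E1; exists y.
  by apply: Ja; rewrite ni.
apply; apply: ENG.
have [Ea|nEa] := pselect (E a); first by left.
by right; apply: NP aE.
Qed.

(** * Integrals of powers *)

Lemma is_derive_shifted_powR (R : realType) (e s x : R) : e < x ->
  is_derive x 1 (fun t => (t - e) `^ s) (s * (x - e) `^ (s - 1)).
Proof.
move=> ex.
have xe : 0 < x - e by rewrite subr_gt0.
have d := is_derive1_powR s xe.
have d2 : is_derive x 1 (fun t : R => t - e) 1.
  have := @is_deriveB _ _ _ id (cst e) x 1 1 0 _ _.
  by rewrite subr0; apply.
by have := @is_derive1_comp R (@powR R ^~ s) (fun t => t - e) x _ _ d d2; rewrite mulr1.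
Qed.

Lemma continuous_shifted_powR (R : realType) (e s x : R) : e < x ->
  {for x, continuous (fun t => (t - e) `^ s)}.
Proof.
move=> ex; apply/differentiable_continuous/derivable1_diffP.
by have [] := is_derive_shifted_powR s ex.
Qed.

Lemma measurable_shifted_powR (R : realType) (k e s : R) :
  measurable_fun [set: R] (fun t : R => k * (t - e) `^ s).
Proof.
apply: measurable_funM => //; apply: (measurableT_comp (measurable_powR s)).
exact: measurable_funB.
Qed.

Lemma integral_shifted_powR (R : realType) (e s a b : R) : e < a -> a <= b ->
  (\int[lebesgue_measure]_(t in `]a, b[) (s * (t - e) `^ (s - 1))%:E =
   ((b - e) `^ s - (a - e) `^ s)%:E)%E.
Proof.
move=> ea; rewrite le_eqVlt => /predU1P[<-|ab].
  by rewrite set_itvoo0 integral_set0 subrr.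
have pos x : x \in `[a, b] -> e < x.
  by rewrite in_itv/= => /andP[ax _]; exact: lt_le_trans ax.
rewrite -(integral_itv_bndoo true false).
  rewrite (@continuous_FTC2 _ _ (fun t => (t - e) `^ s)) ?EFinB//.
  - apply: continuous_in_subspaceT => x /set_mem /= /pos x0.
    by apply: cvgM; [exact: cvg_cst|exact: continuous_shifted_powR].
  - split.
    + by move=> x /subset_itv_oo_cc /pos x0; have [] := is_derive_shifted_powR s x0.
    + by apply: cvg_at_right_filter; apply: continuous_shifted_powR.
    + by apply: cvg_at_left_filter; apply: continuous_shifted_powR; exact: lt_trans ab.
  - move=> x /subset_itv_oo_cc /pos x0; rewrite derive1E.
    by have [_ ->] := is_derive_shifted_powR s x0.
apply/measurable_EFinP; exact: measurable_funTS (measurable_shifted_powR _ _ _).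
Qed.

(** The integrand may be singular at e, where the fundamental theorem of
    calculus does not apply: exhaust the interval from the right of e. *)
Lemma integral_shifted_powR0 (R : realType) (e s b : R) : 0 < s -> e < b ->
  (\int[lebesgue_measure]_(t in `]e, b[) (s * (t - e) `^ (s - 1))%:E =
   ((b - e) `^ s)%:E)%E.
Proof.
move=> s0 eb.
have be : 0 < b - e by rewrite subr_gt0.
pose u n : R := e + (b - e) / n.+1%:R.
pose F n : set R := `]u n, b[%classic.
have eu n : e < u n by rewrite ltrDl divr_gt0.
have ub n : u n <= b.
  rewrite -lerBrDl ler_pdivrMr// ler_peMr ?ler1n//; exact: ltW.
have du : {homo u : i j / (i <= j)%N >-> j <= i}.
  by move=> i j ij; rewrite lerD2l ler_pM2l// lef_pV2 ?posrE// ler_nat ltnS.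
have u_e : u n @[n --> \oo] --> e.
  rewrite -[X in _ --> X]addr0; apply: cvgD; first exact: cvg_cst.
  rewrite -[X in _ --> X](mulr0 (b - e)); apply: cvgM; first exact: cvg_cst.
  exact: cvg_harmonic.
have FE : `]e, b[%classic = \bigcup_n F n.
  apply/seteqP; split => t /=.
    rewrite in_itv/= => /andP[et tb].
    have [n _ /(_ n (leqnn n)) un] := cvgr_lt e u_e t et.
    by exists n => //; apply/andP.
  by move=> [n _] /andP[un tb]; rewrite in_itv/= (lt_trans (eu n) un).
have mF n : measurable_fun (F n) (fun t : R => (s * (t - e) `^ (s - 1))%:E).
  by apply/measurable_EFinP; exact: measurable_funTS (measurable_shifted_powR _ _ _).
have H : (\int[lebesgue_measure]_(t in F n) (s * (t - e) `^ (s - 1))%:E)%E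
    @[n --> \oo] --> (\int[lebesgue_measure]_(t in `]e, b[) (s * (t - e) `^ (s - 1))%:E)%E.
  rewrite FE; apply: ge0_nondecreasing_set_cvg_integral => //.
  - move=> i j ij; apply/subsetPset => t /andP[ut tb]; apply/andP; split => //.
    exact: le_lt_trans (du _ _ ij) ut.
  - by move=> n; exact: measurable_itv.
  - by move=> n t _; rewrite lee_fin mulr_ge0 ?powR_ge0// ltW.
move: H; under eq_fun do rewrite integral_shifted_powR//.
move=> H; apply: (cvg_unique _ H) => //.
apply: cvg_EFin; first exact: nearW.
rewrite -[X in _ --> X]subr0; apply: cvgB; first exact: cvg_cst.
have ue0 : (u n - e) @[n --> \oo] --> 0^'+.
  move=> P P0.
  have : (u n - e) @[n --> \oo] --> e - e by apply: cvgB => //; exact: cvg_cst.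
  rewrite subrr => /(_ _ P0) uP.
  suff : \forall n \near \oo, P (u n - e) by [].
  have : \forall n \near \oo, 0 < u n - e -> P (u n - e) by exact: uP.
  by apply: filterS => n; apply; rewrite subr_gt0.
exact: cvg_comp ue0 (powR_cvg0 s0).
Qed.

Lemma integral_powR (R : realType) (s a b : R) : 0 < a -> a <= b ->
  (\int[lebesgue_measure]_(t in `]a, b[) (s * t `^ (s - 1))%:E =
   (b `^ s - a `^ s)%:E)%E.
Proof.
move=> a0 ab; have := integral_shifted_powR s a0 ab.
by rewrite !subr0; under eq_integral do rewrite subr0.
Qed.

(** * From superlevel sets to powers *)

Lemma measurable_scaled_powR (R : realType) (k s : R) :
  measurable_fun [set: R] (fun t : R => k * t `^ s).
Proof. by apply: measurable_funM => //; exact: measurable_powR. Qed.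

Lemma measurable_lt_fun d (T : measurableType d) (R : realType) (D : set T)
    (f g : T -> R) : measurable D -> measurable_fun D f -> measurable_fun D g ->
  measurable (D `&` [set x | f x < g x]).
Proof.
move=> mD mf mg; under eq_set => x do rewrite -lte_fin.
by apply: measurable_lte => //; exact/measurable_EFinP.
Qed.

(** Both sides integrate u x * w t over the pairs with a < t < min (f x) b.
    Measurability of the inner integral h is part of the conclusion because it
    also comes from Tonelli's theorem. *)
Lemma layer_cake d (T : measurableType d) (R : realType)
    (mu : {sigma_finite_measure set T -> \bar R}) (D : set T) (f : T -> R)
    (u : T -> \bar R) (w : R -> \bar R) (a b : R) :
  measurable D -> measurable_fun D f -> measurable_fun D u ->
  (forall x, D x -> 0 <= u x)%E ->
  measurable_fun [set: R] w -> (forall t, a < t -> (0 <= w t)%E) ->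
  let h t := (w t * \int[mu]_(x in D `&` [set x | (t < f x)%R]) u x)%E in
  measurable_fun `]a, b[ h /\
  (\int[mu]_(x in D)
     (u x * \int[lebesgue_measure]_(t in `]a, (Num.min (f x) b)[) w t) =
   \int[lebesgue_measure]_(t in `]a, b[) h t)%E.
Proof.
move=> mD mf mu0 u0 mw w0 h.
pose f' := f \_ D.
have mf' : measurable_fun [set: T] f' by apply/(measurable_restrictT _ _).1.
pose u' := u \_ D.
have mu' : measurable_fun [set: T] u' by apply/(measurable_restrictT _ _).1.
have u'0 x : (0 <= u' x)%E by apply: erestrict_ge0.
pose w' := w \_ `]a, b[.
have mw' : measurable_fun [set: R] w'.
  by apply/(measurable_restrictT _ _).1 => //; exact: measurable_funTS.
have w'0 t : (0 <= w' t)%E.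
  by apply: erestrict_ge0 => s /=; rewrite in_itv/= => /andP[/w0].
pose S := [set z : T * R | z.2 < f' z.1].
have mS : measurable S.
  rewrite (_ : S = [set: T * R] `&` [set z | (z.2 < f' z.1)%R]); last by rewrite setTI.
  apply: measurable_lt_fun => //.
  exact: (measurableT_comp mf' measurable_fst).
pose F (z : T * R) := (u' z.1 * w' z.2 * (\1_S z)%:E)%E.
have mF : measurable_fun [set: T * R] F.
  apply: emeasurable_funM; first apply: emeasurable_funM.
  - exact: (measurableT_comp mu' measurable_fst).
  - exact: (measurableT_comp mw' measurable_snd).
  - by apply/measurable_EFinP; exact: measurable_indic.
have SE x t : (\1_S (x, t) : R) = (t < f' x)%R%:R.
  by rewrite indicE; case: ltP => tx; [rewrite mem_set|rewrite memNset//= => /(le_lt_trans tx); rewrite ltxx].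
have itvE (t x : R) : (t \in `]a, x[%classic) = (a < t < x)%R.
  by rewrite mem_setE in_itv.
have F0 z : (0 <= F z)%E by rewrite /F !mule_ge0// lee_fin.
have hE : (fun t => \int[mu]_x F (x, t))%E = h \_ `]a, b[.
  apply/funext => t.
  rewrite [RHS]/patch; case: ifPn => tab; last first.
    rewrite integral0_eq// => x _; rewrite /F/= /w' /patch (negbTE tab).
    by rewrite mule0 mul0e.
  rewrite /h; have w0' : (0 <= w t)%E.
    by move: tab; rewrite inE/= in_itv/= => /andP[/w0].
  rewrite [in RHS]integral_mkcond -ge0_integralZl//; last 2 first.
  - apply/(measurable_restrictT _ _).1.
      exact: measurable_lt_fun.
    by apply: measurable_funS mu0 => // x [].
  - by move=> x _; apply: erestrict_ge0 => {}x [/u0].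
  apply: eq_integral => x _; rewrite /F/= SE /w' /u' /f' /patch tab in_setI.
  case: ifPn => xD /=; last by rewrite !mul0e mule0.
  rewrite (_ : (x \in _) = (t < f x)%R).
    by case: (t < f x); rewrite ?mule1 ?mule0// muleC.
  by case: ltP => tx; [rewrite mem_set|rewrite memNset//= => /(le_lt_trans tx); rewrite ltxx].
split.
  apply/(measurable_restrictT _ _).2 => //; rewrite -hE.
  exact: measurable_fun_fubini_tonelli_G.
transitivity (\int[mu]_x \int[lebesgue_measure]_t F (x, t))%E.
  rewrite integral_mkcond; apply: eq_integral => x _.
  rewrite /patch; case: ifPn => xD; last first.
    rewrite integral0_eq// => t _; rewrite /F/= /u' /patch (negbTE xD).
    by rewrite !mul0e.
  rewrite integral_mkcond -ge0_integralZl//; last 3 first.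
  - apply/(measurable_restrictT _ _).1 => //; exact: measurable_funTS.
  - move=> t _; apply: erestrict_ge0 => {}t /=.
    by rewrite in_itv/= => /andP[/w0].
  - exact/u0/set_mem.
  apply: eq_integral => t _.
  rewrite /F/= SE /u' /w' /f' /patch xD -muleA; congr (_ * _)%E.
  rewrite !itvE lt_min.
  by case: (a < t); case: (t < b); case: (t < f x); rewrite ?mule1 ?mule0.
by rewrite fubini_tonelli// [RHS]integral_mkcond -hE.
Qed.

(** Let g = min(f, b), and let Y and Z be the integrals of g ^ p - a ^ p and of
    f (g ^ (p - 1) - a ^ (p - 1)).  By [layer_cake] with the weights p t ^ (p - 1)
    and (p - 1) t ^ (p - 2), the superlevel bound integrates to Z <= k Y with
    k = c (p - 1) / p < 1.  As g ^ p <= f g ^ (p - 1), the integral X = Y + a ^ p m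
    of g ^ p is at most Z + a ^ (p - 1) S, and X, being finite thanks to the
    truncation, can be absorbed on the left. *)
Lemma truncated_power_integral d (T : measurableType d) (R : realType)
    (mu : {sigma_finite_measure set T -> \bar R}) (D : set T) (f : T -> R)
    (a c p b m S : R) :
  measurable D -> measurable_fun D f -> 0 < a -> (forall x, D x -> a <= f x) ->
  1 <= p -> 0 <= c -> 0 < c + p - p * c -> mu D = m%:E ->
  (\int[mu]_(x in D) (f x)%:E = S%:E)%E ->
  (forall t, a < t ->
    (\int[mu]_(x in D `&` [set x | (t < f x)%R]) (f x)%:E <=
      (c * t)%:E * mu (D `&` [set x | (t < f x)%R]))%E) ->
  a <= b ->
  (\int[mu]_(x in D) (Num.min (f x) b `^ p)%:E <=
    (a `^ (p - 1) * (p * S - c * (p - 1) * a * m) / (c + p - p * c))%:E)%E.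
Proof.
move=> mD mf a0 af p1 c0 cp muD Sf weak ab.
have p0 : 0 < p by exact: lt_le_trans p1.
have fgt0 x : D x -> 0 < f x by move=> /af; exact: lt_le_trans.
pose g x := Num.min (f x) b.
have ag x : D x -> a <= g x by move=> Dx; rewrite le_min af.
have gb x : g x <= b by rewrite ge_min lexx orbT.
have ggt0 x : D x -> 0 < g x by move=> /ag; exact: lt_le_trans.
have mg : measurable_fun D g by exact: measurable_minr.
have mgp (q : R) : measurable_fun D (fun x => g x `^ q).
  exact: (measurableT_comp (measurable_powR q)).
have mlev t : measurable (D `&` [set x | t < f x]).
  by apply: measurable_lt_fun.
have ple (q x y : R) : 0 <= q -> 0 < x -> x <= y -> x `^ q <= y `^ q.
  by move=> q0 x0 xy; apply: ge0_ler_powR; rewrite ?nnegrE// ltW// (lt_le_trans x0).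
have p10 : 0 <= p - 1 by rewrite subr_ge0.
have w0 (q : R) : 0 <= q -> forall t : R, a < t -> (0 <= (q * t `^ (q - 1))%:E)%E.
  by move=> q0 t _; rewrite lee_fin mulr_ge0// powR_ge0.
have mw (q : R) : measurable_fun [set: R] (fun t : R => (q * t `^ (q - 1))%:E).
  by apply/measurable_EFinP; exact: measurable_scaled_powR.
have [mY eY] := @layer_cake _ _ _ mu D f (cst 1%E) _ a b mD mf
  (measurable_cst 1%E) (fun _ _ => lee01) (mw p) (w0 p (ltW p0)).
have mfE : measurable_fun D (EFin \o f) by exact/measurable_EFinP.
have f0E x : D x -> (0 <= (EFin \o f) x)%E by move=> /fgt0/ltW.
have [mZ eZ] := @layer_cake _ _ _ mu D f _ _ a b mD mf mfE f0E (mw (p - 1)) (w0 (p - 1) p10).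
pose Y := (\int[mu]_(x in D) (g x `^ p - a `^ p)%:E)%E.
pose Z := (\int[mu]_(x in D) (f x * (g x `^ (p - 1) - a `^ (p - 1)))%:E)%E.
have {}eY : Y = (\int[lebesgue_measure]_(t in `]a, b[) ((p * t `^ (p - 1))%:E *
    \int[mu]_(x in D `&` [set x | (t < f x)%R]) cst 1 x))%E.
  rewrite -eY; apply: eq_integral => x /set_mem Dx.
  by rewrite mul1e integral_powR// ag.
have {}eZ : Z = (\int[lebesgue_measure]_(t in `]a, b[)
    (((p - 1) * t `^ (p - 1 - 1))%:E *
    \int[mu]_(x in D `&` [set x | (t < f x)%R]) (f x)%:E))%E.
  rewrite -eZ; apply: eq_integral => x /set_mem Dx.
  by rewrite integral_powR ?ag// EFinM.
pose k := c * (p - 1) / p.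
have k0 : 0 <= k by rewrite divr_ge0 ?mulr_ge0// ltW.
have ZY : (Z <= k%:E * Y)%E.
  rewrite eY eZ -ge0_integralZl//; last first.
    move=> t /=; rewrite in_itv/= => /andP[at_ _]; rewrite mule_ge0//.
      exact: w0 (ltW p0) _ at_.
    by apply: integral_ge0.
  apply: ge0_le_integral => //.
  - move=> t /=; rewrite in_itv/= => /andP[at_ _]; rewrite mule_ge0//.
      exact: w0 at_.
    by apply: integral_ge0 => x [/f0E].
  - by apply: measurable_funeM.
  move=> t /=; rewrite in_itv/= => /andP[at_ _].
  have t0 : 0 < t by exact: lt_trans at_.
  apply: (le_trans (lee_wpmul2l _ (weak t at_))); first exact: w0 at_.
  rewrite integral_cst// mul1e !muleA -!EFinM; apply: lee_wpmul2r => //.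
  have tE : t `^ (p - 1) = t `^ (p - 1 - 1) * t.
    have := @powRD _ t (p - 1 - 1) 1.
    rewrite subrK (powRr1 (ltW t0)) (gt_eqF t0) implybT; exact.
  rewrite lee_fin /k tE.
  by rewrite le_eqVlt; apply/orP; left; apply/eqP; field; rewrite gt_eqF.
have integral_cstD r : (\int[mu]_(x in D) (cst r%:E) x = (r * m)%:E)%E.
  by rewrite integral_cst// EFinM -muD.
pose X := (\int[mu]_(x in D) (g x `^ p)%:E)%E.
have b0 : 0 < b by exact: lt_le_trans ab.
have gpE q : measurable_fun D (fun x => (g x `^ q)%:E) by exact/measurable_EFinP.
have X0 : (0 <= X)%E.
  by apply: integral_ge0 => x _; rewrite lee_fin powR_ge0.
have Xfin : X \is a fin_num.
  rewrite ge0_fin_numE//.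
  apply: (@le_lt_trans _ _ (\int[mu]_(x in D) (cst (b `^ p)%:E) x)%E).
    apply: ge0_le_integral => //.
    - by move=> x _; rewrite lee_fin powR_ge0.
    - by move=> x Dx; rewrite lee_fin; apply: ple; [exact: ltW|exact: ggt0|exact: gb].
  by rewrite integral_cstD ltry.
have XY : X = (Y + (a `^ p * m)%:E)%E.
  rewrite -integral_cstD -ge0_integralD//.
  - by apply: eq_integral => x _; rewrite -EFinD subrK.
  - move=> x Dx; rewrite lee_fin subr_ge0; by apply: ple; [exact: ltW|exact: a0|exact: ag].
  - by apply/measurable_EFinP; exact: measurable_funB.
  - by move=> x _; rewrite lee_fin powR_ge0.
have XZ : (X <= Z + (a `^ (p - 1) * S)%:E)%E.
  rewrite EFinM -Sf -ge0_integralZl//; last by rewrite lee_fin powR_ge0.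
  rewrite -ge0_integralD//.
  - apply: ge0_le_integral => //.
    + by move=> x _; rewrite lee_fin powR_ge0.
    + apply: emeasurable_funD.
        apply/measurable_EFinP; apply: measurable_funM => //.
        exact: measurable_funB.
      by apply: measurable_funeM.
    move=> x Dx; rewrite -EFinM -EFinD lee_fin.
    rewrite mulrBr [a `^ _ * _]mulrC subrK -(mulr_powRB1 (ltW (ggt0 x Dx)) p0).
    by rewrite ler_wpM2r ?powR_ge0// ge_min lexx.
  - move=> x Dx; rewrite lee_fin mulr_ge0 ?(ltW (fgt0 _ Dx))// subr_ge0.
    by apply: ple => //; exact: ag.
  - apply/measurable_EFinP; apply: measurable_funM => //.
    exact: measurable_funB.
  - by move=> x Dx; rewrite mule_ge0// ?f0E// lee_fin powR_ge0.
  - by apply: measurable_funeM.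
have Yfin : Y \is a fin_num.
  by move: Xfin; rewrite XY fin_numD => /andP[].
rewrite -/X -(fineK Xfin) lee_fin ler_pdivlMr//.
move: XZ; rewrite -(fineK Xfin) => /le_trans => /(_ _ (leeD2r _ ZY)).
move: XY; rewrite -(fineK Xfin) -(fineK Yfin) -EFinD => -[].
move: (fine X) (fine Y) => x y -> {X X0 Xfin Yfin}.
rewrite -EFinM -EFinD lee_fin => H.
have apE : a `^ p = a * a `^ (p - 1) by rewrite mulr_powRB1// ltW.
have kE : c * (p - 1) = k * p by rewrite /k; field; rewrite gt_eqF.
have -> : c + p - p * c = p * (1 - k).
  by rewrite mulrBr mulr1 [p * k]mulrC -kE; ring.
have -> : a `^ (p - 1) * (p * S - c * (p - 1) * a * m) =
  p * (a `^ (p - 1) * S - k * (a `^ p * m)) by rewrite kE apE; ring.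
rewrite mulrCA ler_pM2l//.
by move: H => /= H; lra.
Qed.

(** The bound on the truncated integrals does not depend on the truncation. *)
Lemma power_integral_le d (T : measurableType d) (R : realType)
    (mu : {sigma_finite_measure set T -> \bar R}) (D : set T) (f : T -> R)
    (a c p m S : R) :
  measurable D -> measurable_fun D f -> 0 < a -> (forall x, D x -> a <= f x) ->
  1 <= p -> 0 <= c -> 0 < c + p - p * c -> mu D = m%:E ->
  (\int[mu]_(x in D) (f x)%:E = S%:E)%E ->
  (forall t, a < t ->
    (\int[mu]_(x in D `&` [set x | (t < f x)%R]) (f x)%:E <=
      (c * t)%:E * mu (D `&` [set x | (t < f x)%R]))%E) ->
  (\int[mu]_(x in D) (f x `^ p)%:E <=
    (a `^ (p - 1) * (p * S - c * (p - 1) * a * m) / (c + p - p * c))%:E)%E.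
Proof.
move=> mD mf a0 af p1 c0 cp muD Sf weak.
have p0 : 0 <= p by exact: le_trans p1.
pose g n x : \bar R := (Num.min (f x) (a + n%:R) `^ p)%:E.
have mg n : measurable_fun D (g n).
  apply/measurable_EFinP; apply: (measurableT_comp (measurable_powR p)).
  exact: measurable_minr.
have g0 n x : D x -> (0 <= g n x)%E by rewrite lee_fin powR_ge0.
have gnd x : D x -> nondecreasing_seq (g^~ x).
  move=> Dx i j ij; rewrite lee_fin ge0_ler_powR// ?nnegrE.
  - by rewrite le_min ltW ?(lt_le_trans a0 (af _ Dx))// addr_ge0// ltW.
  - by rewrite le_min ltW ?(lt_le_trans a0 (af _ Dx))// addr_ge0// ltW.
  - by rewrite le_min ge_min lexx/= ge_min lerD2l ler_nat ij orbT.
have gl x : D x -> g n x @[n --> \oo] --> (f x `^ p)%:E.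
  move=> Dx; apply: cvg_near_cst; near=> n; rewrite /g min_l//.
  apply: (@le_trans _ _ n%:R); last by rewrite lerDr ltW.
  by near: n; exact: nbhs_infty_ger.
rewrite (_ : \int[mu]_(x in D) _ =
    \int[mu]_(x in D) (fun x => limn (g^~ x)) x)%E; last first.
  by apply: eq_integral => x /set_mem Dx; apply/esym/cvg_lim => //; exact: gl.
rewrite monotone_convergence//; apply: lime_le.
  apply: ereal_nondecreasing_is_cvgn => i j ij; apply: ge0_le_integral => //.
  - by move=> x Dx; exact: g0.
  - by move=> x Dx; exact: gnd.
apply: nearW => n; apply: truncated_power_integral => //.
by rewrite lerDl.
Unshelve. all: by end_near. Qed.

(** * The A1 inequality on an interval *)

Lemma integral_average (R : realType) (I : set R) (f : R -> R) :
  (0 < leb R I < +oo)%E ->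
  (\int[leb R]_(x in I) (f x)%:E = average I f * leb R I)%E.
Proof.
move=> /andP[I0 Ioo]; rewrite /average muleAC mulVe ?mul1e ?gt_eqF//.
by rewrite ge0_fin_numE// ltW.
Qed.

Lemma average_ge0 (R : realType) (I : set R) (f : R -> R) :
  (forall x, I x -> 0 <= f x) -> (0 <= average I f)%E.
Proof.
move=> f0; rewrite /average mule_ge0// ?inve_ge0//.
by apply: integral_ge0 => x /f0.
Qed.

(** Every use of the essential infimum goes through this: on a set of positive
    measure some value of f is at least the essential infimum. *)
Lemma ess_inf_onP (R : realType) (I A : set R) (f : R -> R) (a : \bar R) :
  measurable (A : set (lebesgue_line R)) -> A `<=` I -> (0 < leb R A)%E ->
  (a <= ess_inf_on I f)%E -> exists2 x, A x & (a <= (f x)%:E)%E.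
Proof.
move=> mA AI A0 /ess_infP[N [mN N0 aN]].
apply: contrapT => nex; move: A0; rewrite ltNge => /negP; apply.
rewrite -N0; apply: le_measure; rewrite ?inE// => x Ax.
apply: aN => /= ax; apply: nex; exists x => //.
by move: ax; rewrite /patch mem_set//; exact: AI.
Qed.

(** This is p < c / (c - 1) cleared of denominators, which needs no convention
    at c = 1. *)
Lemma admissible_exponent_gt0 (R : realType) (c p : R) : 1 <= c ->
  admissible_exponent c p -> 0 < c + p - p * c.
Proof.
move=> c1 [p1]; rewrite /critical_exponent; case: eqP => [->|/eqP cn1]; first by lra.
have c0 : 0 < c - 1 by rewrite subr_gt0 lt_neqAle eq_sym cn1.
by rewrite lte_fin ltr_pdivlMr// mulrBr mulr1; lra.
Qed.

Section A1_interval.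
Variables (R : realType) (I : set R) (phi : R -> R) (c : R).
Hypothesis nI : nondegenerate_interval I.
Hypothesis Ioo : (leb R I < +oo)%E.
Hypothesis mphi : measurable_fun (I : set (lebesgue_line R)) (phi : lebesgue_line R -> R).
Hypothesis phi0 : forall x, I x -> 0 < phi x.
Hypothesis Hc : A1_bound I phi c.

Let mI : measurable (I : set (lebesgue_line R)) := interval_measurable_line nI.1.

Lemma average_le_ess_inf : (average I phi <= c%:E * ess_inf_on I phi)%E.
Proof. exact: Hc.2. Qed.

Lemma ess_inf_on_fin : ess_inf_on I phi \is a fin_num.
Proof.
rewrite ge0_fin_numE; last first.
  apply/ess_infP; apply: aeW => x; rewrite /patch; case: ifPn => // xI.
  by rewrite lee_fin ltW// phi0//; exact: set_mem.
rewrite ltey; apply/eqP => e.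
have [||x _] := @ess_inf_onP R I I phi +oo%E mI _ nI.2 => //.
by rewrite e.
Qed.

Lemma average_fin : average I phi \is a fin_num.
Proof.
rewrite ge0_fin_numE; last by apply: average_ge0 => x /phi0/ltW.
apply: le_lt_trans average_le_ess_inf _.
by rewrite -(fineK ess_inf_on_fin) -EFinM ltry.
Qed.

(** An interval that is not almost contained in the superlevel set contains a
    point with phi <= t, hence has essential infimum at most t, which is the
    hypothesis of [integral_le_covering].  If the superlevel set is almost all
    of I, the claim is the hypothesis on the average. *)
Lemma integral_superlevel_le (t : R) : (average I phi <= (c * t)%:E)%E ->
  (\int[leb R]_(x in I `&` [set x | (t < phi x)%R]) (phi x)%:E <=
   (c * t)%:E * leb R (I `&` [set x | (t < phi x)%R]))%E.
Proof.
move=> At; set E := I `&` _.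
have a0 : (0 <= average I phi)%E by apply: average_ge0 => x /phi0/ltW.
have ct0 : 0 <= c * t by rewrite -lee_fin; exact: le_trans At.
have mE : measurable (E : set (lebesgue_line R)).
  have := mphi mI (measurable_itv `]t, +oo[).
  congr (measurable _); apply/seteqP; split => x [Ix]/=; rewrite in_itv/= andbT//.
have mphiE : measurable_fun (I : set (lebesgue_line R)) (EFin \o phi).
  exact/measurable_EFinP.
have [IE0|] := ltP 0%E (leb R (I `\` E)).
  apply: (@integral_le_covering R I E (EFin \o phi)) => //.
  - exact: nI.1.
  - by move=> x [].
  - by move=> x /phi0 /ltW.
  move=> K iK KI KE.
  have mK := interval_measurable_line iK.
  have K0 : (0 < leb R K)%E.
    apply: (lt_le_trans KE); apply: le_measure; rewrite ?inE//.
      exact: measurableD.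
  rewrite integral_average; last first.
    rewrite K0/=; apply: le_lt_trans Ioo; apply: le_measure; rewrite ?inE//.
  apply: lee_wpmul2r => //.
  apply: (le_trans (Hc.2 K (conj iK K0) KI)).
  rewrite EFinM; apply: lee_wpmul2l; first by rewrite lee_fin (le_trans ler01 Hc.1).
  have [] := @ess_inf_onP R K (K `\` E) phi (ess_inf_on K phi) _ _ KE => //.
  - exact: measurableD.
  - move=> x [Kx nE] /le_trans; apply.
    rewrite lee_fin leNgt; apply/negP => tx; apply: nE; split => //; exact: KI.
move=> IE0.
have EI : leb R E = leb R I.
  apply/eqP; rewrite eq_le; apply/andP; split.
    by apply: le_measure; rewrite ?inE// => x [].
  rewrite -[leRHS]adde0; apply: le_trans (leeD2l _ IE0).
  apply: (@le_trans _ _ (leb R (E `|` I `\` E))); last first.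
    by apply: measureU2 => //; exact: measurableD.
  apply: le_measure; rewrite ?inE//.
    by apply: measurableU => //; exact: measurableD.
  by move=> x Ix; have [Ex|nE] := pselect (E x); [left|right].
rewrite EI; apply: (@le_trans _ _ (\int[leb R]_(x in I) (phi x)%:E)%E).
  apply: ge0_subset_integral => //.
  - by move=> x /phi0 /ltW.
  - by move=> x [].
by rewrite integral_average ?nI.2//; apply: lee_wpmul2r.
Qed.

Lemma average_gt0 : (0 < average I phi)%E.
Proof.
have a0 : (0 <= average I phi)%E by apply: average_ge0 => x /phi0/ltW.
rewrite lt_neqAle a0 andbT eq_sym; apply/eqP => e.
have mphiE : measurable_fun (I : set (lebesgue_line R)) (EFin \o phi).
  exact/measurable_EFinP.
have : (\int[leb R]_(x in I) `|(EFin \o phi) x| = 0)%E.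
  transitivity (\int[leb R]_(x in I) (phi x)%:E)%E.
    by apply: eq_integral => x /set_mem /phi0 px; rewrite /= gtr0_norm.
  by rewrite integral_average ?nI.2// e mul0e.
move=> /(ae_eq_integral_abs (leb R) mI mphiE)[N [mN N0 IN]].
have := nI.2; rewrite ltNge => /negP; apply; rewrite -N0.
apply: le_measure; rewrite ?inE// => x Ix; apply: IN => /= /(_ Ix) -[] px.
by have := phi0 Ix; rewrite px ltxx.
Qed.

(** The points with phi < A / c form a null set by the A1 inequality on I;
    away from them [power_integral_le] applies with a = A / c. *)
Lemma A1_power_average (p : R) : 1 <= p -> 0 < c + p - p * c ->
  (average I (fun x => (phi x `^ p)%R) <=
     (sharp_constant c p)%:E * average I phi `^ p)%E.
Proof.
move=> p1 cp.
have c1 : 1 <= c := Hc.1.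
have c0 : 0 < c by exact: lt_le_trans c1.
have Afin := average_fin.
have Agt0 := average_gt0.
have mfin : leb R I \is a fin_num by rewrite ge0_fin_numE.
have := @integral_average R I phi; rewrite nI.2 Ioo => /(_ isT).
have Hw := integral_superlevel_le.
have He := average_le_ess_inf.
move: Afin Agt0 Hw He => /fineK; move: (fine (average I phi)) => A <-.
rewrite lte_fin => A0 Hw He iA.
have m0 := nI.2; rewrite {1}/average; move: mfin m0 => /fineK.
move mE : (fine (leb R I)) => m {mE} Im; rewrite -Im lte_fin => m0.
pose a := A / c.
have a0 : 0 < a by rewrite divr_gt0.
pose B := I `&` [set x | phi x < a].
have mB : measurable (B : set (lebesgue_line R)).
  by apply: measurable_lt_fun.
have B0 : leb R B = 0%E.
  apply/eqP; rewrite -measure_le0 leNgt; apply/negP => Bp.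
  have [x [Ix xa]] := @ess_inf_onP R I B phi _ mB (@subIsetl _ _ _) Bp (lexx _).
  move=> ex; have : (A%:E <= (c * phi x)%:E)%E.
    by apply: (le_trans He); rewrite EFinM; apply: lee_wpmul2l => //; rewrite lee_fin ltW.
  by rewrite lee_fin leNgt -ltr_pdivlMl// mulrC xa.
pose D := I `\` B.
have mD : measurable (D : set (lebesgue_line R)) by exact: measurableD.
have DI : D `<=` I by move=> x [].
have mphiD : measurable_fun (D : set (lebesgue_line R)) (phi : lebesgue_line R -> R).
  exact: measurable_funS mphi.
have aD x : D x -> a <= phi x.
  by move=> [Ix nB]; rewrite leNgt; apply/negP => xa; apply: nB.
have muD : leb R D = m%:E.
  have IB : I `&` B = B by rewrite setIidr//; exact: subIsetl.
  by rewrite Im (measureDI (leb R) mI mB) IB [X in (_ + X)%E]B0 adde0.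
have intD (f : R -> R) :
    measurable_fun (I : set (lebesgue_line R)) (f : lebesgue_line R -> R) ->
    (forall x, I x -> 0 <= f x) ->
    (\int[leb R]_(x in I) (f x)%:E = \int[leb R]_(x in D) (f x)%:E)%E.
  move=> mf f0; apply: ge0_negligible_integral => //.
  exact/measurable_EFinP.
have mp : measurable_fun (I : set (lebesgue_line R))
    ((fun x => phi x `^ p) : lebesgue_line R -> R).
  exact: (measurableT_comp (measurable_powR p)).
have intp : (\int[leb R]_(x in I) (phi x `^ p)%:E <=
    (a `^ (p - 1) * (p * (A * m) - c * (p - 1) * a * m) / (c + p - p * c))%:E)%E.
  rewrite intD//; last by move=> x _; rewrite powR_ge0.
  apply: power_integral_le => //.
  - exact: ltW.
  - rewrite -intD//; first by rewrite iA EFinM Im.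
    by move=> x /phi0 /ltW.
  move=> t at_.
  have DE : D `&` [set x | (t < phi x)%R] = I `&` [set x | (t < phi x)%R].
    apply/seteqP; split => x [].
      by move=> [Ix _] tx.
    move=> Ix tx; split => //; split => // -[_ /=]; apply/negP.
    by rewrite -leNgt ltW// (lt_trans at_).
  rewrite DE; apply: Hw; rewrite lee_fin mulrC -ler_pdivrMr//; exact: ltW.
rewrite inver gt_eqF//.
apply: (le_trans (lee_wpmul2l _ intp)); first by rewrite lee_fin invr_ge0 ltW.
rewrite -EFinM poweR_EFin -EFinM lee_fin /sharp_constant.
have cpE : c `^ (p - 1) != 0 by rewrite gt_eqF// powR_gt0.
have p0 : 0 < p by exact: lt_le_trans p1.
have aE : a `^ (p - 1) = A `^ (p - 1) / c `^ (p - 1).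
  rewrite /a powRM ?invr_ge0 ?(ltW A0) ?(ltW c0)//.
  by rewrite -powR_inv1 ?(ltW c0)// -powRrM mulN1r powRN.
rewrite -(mulr_powRB1 (ltW A0) p0) aE /a.
rewrite le_eqVlt; apply/orP; left; apply/eqP; field.
by rewrite !gt_eqF// powR_gt0.
Qed.
End A1_interval.

Lemma A1_boundS (R : realType) (I J : set R) (phi : R -> R) (c : R) :
  I `<=` J -> A1_bound J phi c -> A1_bound I phi c.
Proof.
by move=> IJ [c1 H]; split=> // K nK KI; apply: H => //; exact: subset_trans IJ.
Qed.

(** The power average is finite, being bounded by a power of the finite average
    of phi. *)
Lemma A1_Lp_on (R : realType) (J : set R) (phi : R -> R) (c p : R) :
  nondegenerate_interval J -> (leb R J < +oo)%E ->
  measurable_fun (J : set (lebesgue_line R)) (phi : lebesgue_line R -> R) ->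
  (forall x, J x -> 0 < phi x) -> A1_bound J phi c ->
  1 <= p -> 0 < c + p - p * c -> Lp_on J p phi.
Proof.
move=> nJ Joo mphi phi0 Hc p1 cp.
have mJ := interval_measurable_line nJ.1.
have p0 : 0 < p by exact: lt_le_trans p1.
have fin : (\int[leb R]_(x in J) (phi x `^ p)%:E < +oo)%E.
  rewrite integral_average ?nJ.2//.
  have H := A1_power_average nJ Joo mphi phi0 Hc p1 cp.
  apply: (le_lt_trans (lee_wpmul2r _ H)) => //.
  rewrite -(fineK (average_fin nJ phi0 Hc)) poweR_EFin -EFinM.
  have mfin : leb R J \is a fin_num by rewrite ge0_fin_numE.
  by rewrite -(fineK mfin) -EFinM ltry.
apply/andP; split; rewrite inE/=.
  exact/(measurable_restrictT _ _).1.
rewrite /finite_norm unlock; apply: poweR_lty.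
apply: le_lt_trans fin; rewrite [leRHS]integral_mkcond.
rewrite le_eqVlt; apply/orP; left; apply/eqP.
apply: eq_integral => x _; rewrite /= /patch; case: ifPn => xJ.
  by rewrite gtr0_norm// phi0//; exact: set_mem.
by rewrite /point/= normr0 powR0// gt_eqF.
Qed.

(** * The extremal power weight *)

(** The value 1 left of a and at a only serves to make the weight positive
    everywhere. *)
Definition power_weight (R : realType) (a s x : R) : R :=
  if a < x then (x - a) `^ s else 1.

Lemma power_weight_gt0 (R : realType) (a s x : R) : 0 < power_weight a s x.
Proof. by rewrite /power_weight; case: ifPn => // ax; rewrite powR_gt0 ?subr_gt0. Qed.

Lemma power_weightX (R : realType) (a s p x : R) :
  power_weight a s x `^ p = power_weight a (s * p) x.
Proof. by rewrite /power_weight; case: ifP => _; rewrite ?powR1 -?powRrM. Qed.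

Lemma measurable_power_weight (R : realType) (a s : R) :
  measurable_fun [set: R] (power_weight a s).
Proof.
apply: measurable_fun_ifT => //; first exact: measurable_fun_ltr.
by apply: (measurableT_comp (measurable_powR s)); exact: measurable_funB.
Qed.

Lemma power_weight_nincr (R : realType) (a s x y : R) : s <= 0 -> a < x -> x <= y ->
  power_weight a s y <= power_weight a s x.
Proof.
move=> s0 ax xy; have ay := lt_le_trans ax xy.
have x0 : 0 < x - a by rewrite subr_gt0.
have y0 : 0 < y - a by rewrite subr_gt0.
rewrite /power_weight ax ay -[s]opprK !(powRN _ (- s)).
rewrite lef_pV2 ?posrE ?powR_gt0//.
by apply: ge0_ler_powR; rewrite ?oppr_ge0 ?nnegrE ?lerB// ltW.
Qed.

Lemma integral_power_weight (R : realType) (a q u v : R) (b0 b1 : bool) :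
  0 < q -> a <= u -> u < v ->
  (\int[leb R]_(x in [set` Interval (BSide b0 u) (BSide b1 v)])
      (power_weight a (q - 1) x)%:E =
   (((v - a) `^ q - (u - a) `^ q) / q)%:E)%E.
Proof.
move=> q0 au uv.
have mw (D : set R) : measurable_fun D (fun x => (power_weight a (q - 1) x)%:E).
  by apply/measurable_EFinP; exact: measurable_funTS (measurable_power_weight _ _).
rewrite integral_leb//; last by move=> x _; rewrite lee_fin ltW// power_weight_gt0.
rewrite integral_itv_bndoo//.
transitivity (\int[lebesgue_measure]_(t in `]u, v[)
    (q^-1%:E * (q * (t - a) `^ (q - 1))%:E))%E.
  apply: eq_integral => t /set_mem /=; rewrite in_itv/= => /andP[ut _].
  by rewrite /power_weight (le_lt_trans au ut) -EFinM mulKf// gt_eqF.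
rewrite ge0_integralZl//; last 3 first.
- by apply/measurable_EFinP; exact: measurable_funTS (measurable_shifted_powR _ _ _).
- by move=> t _; rewrite lee_fin mulr_ge0 ?powR_ge0// ltW.
- by rewrite lee_fin invr_ge0 ltW.
move: au; rewrite le_eqVlt => /predU1P[au|au].
  rewrite -au integral_shifted_powR0//; last by rewrite au.
  by rewrite subrr powR0 ?gt_eqF// subr0 -EFinM mulrC.
by rewrite integral_shifted_powR ?(ltW uv)// -EFinM mulrC.
Qed.

Section extremal_weight.
Variables (R : realType) (a b c : R) (b0 b1 : bool).
Hypotheses (ab : a < b) (c1 : 1 <= c).
Let J : set R := [set` Interval (BSide b0 a) (BSide b1 b)].
Let phi := power_weight a (c^-1 - 1).

Let c0 : 0 < c. Proof. exact: lt_le_trans c1. Qed.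
Let ci0 : 0 < c^-1. Proof. by rewrite invr_gt0. Qed.
Let s0 : c^-1 - 1 <= 0. Proof. by rewrite subr_le0 invf_le1. Qed.

Let average_itv (u v : R) (b2 b3 : bool) (f : R -> R) (k : R) : u < v ->
  (\int[leb R]_(x in [set` Interval (BSide b2 u) (BSide b3 v)]) (f x)%:E = k%:E)%E ->
  average [set` Interval (BSide b2 u) (BSide b3 v)] f = (k / (v - u))%:E.
Proof.
move=> uv H; rewrite /average H leb_itv// inver gt_eqF ?subr_gt0//.
by rewrite -EFinM mulrC.
Qed.

(** With U = u - a, V = v - a and r = 1 / c, the claim on an interval with
    endpoints u < v is V ^ r - U ^ r <= (V - U) V ^ (r - 1), that is
    U V ^ (r - 1) <= U ^ r, which holds because r <= 1. *)
Lemma power_weight_A1_bound : A1_bound J phi c.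
Proof.
split=> // K nK KJ.
have Joo : (leb R J < +oo)%E by rewrite leb_itv// ltry.
have Koo : (leb R K < +oo)%E by apply: le_lt_trans Joo; exact: le_outer_measure.
have [u [v [b2 [b3 [uv KE]]]]] := nondegenerate_itv nK Koo.
have [au vb] : a <= u /\ v <= b.
  apply: itv_sub_endpoints uv _.
  apply: (@subset_trans _ K); first by rewrite KE; exact: subset_itvW.
  apply: (subset_trans KJ); rewrite /J.
  by apply: subset_itv; [case: (b0)|case: (b1)]; rewrite bnd_simp.
have av : a < v by exact: le_lt_trans uv.
have vpos : 0 < v - a by rewrite subr_gt0.
have essK : ((phi v)%:E <= ess_inf_on K phi)%E.
  (* The point a has to be excepted: phi a = 1 may be smaller than phi v. *)
  apply/ess_infP; exists [set a]; split.
  - exact: measurable_line.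
  - by rewrite leb_lebesgue lebesgue_measure_set1.
  move=> x /=; rewrite /patch; case: ifPn => [/set_mem Kx|_]; last by rewrite leey.
  apply: contra_notP => /eqP xa.
  have [ux xv] : u <= x /\ x <= v.
    move: Kx; rewrite KE => /= /(subset_itv _ _) H.
    have : x \in `[u, v] by apply: H; [case: (b2)|case: (b3)]; rewrite bnd_simp.
    by rewrite in_itv/= => /andP.
  by rewrite lee_fin; apply: power_weight_nincr => //; rewrite lt_neqAle eq_sym xa (le_trans au).
apply: (@le_trans _ _ (c%:E * (phi v)%:E)%E); last first.
  by apply: lee_wpmul2l => //; rewrite lee_fin ltW.
rewrite {1}KE (average_itv uv (integral_power_weight _ _ ci0 au uv)).
rewrite -EFinM lee_fin invrK ler_pdivrMr ?subr_gt0//.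
rewrite mulrC -mulrA ler_pM2l//.
have phiv : phi v = (v - a) `^ (c^-1 - 1) by rewrite /phi /power_weight av.
suff : (u - a) * phi v <= (u - a) `^ c^-1.
  by rewrite -(mulr_powRB1 (ltW vpos) ci0) -phiv; lra.
move: au; rewrite le_eqVlt => /predU1P[<-|au'].
  by rewrite subrr mul0r powR_ge0.
have upos : 0 < u - a by rewrite subr_gt0.
rewrite -(mulr_powRB1 (ltW upos) ci0) ler_pM2l//.
have := power_weight_nincr s0 au' (ltW uv).
by rewrite {2}/power_weight au'.
Qed.

(** On J itself the average is c times the value at b, whereas the essential
    infimum is at most the value at any y < b; letting y tend to b excludes any
    constant smaller than c. *)
Lemma power_weight_A1_with_constant : A1_with_constant J c phi.
Proof.
split.
  split; last by exists c; exact: power_weight_A1_bound.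
    have m := measurable_power_weight a (c^-1 - 1).
    have mi := @measurable_id_line R.
    apply: measurable_funTS.
    exact: (measurableT_comp m mi).
  by move=> x _; exact: power_weight_gt0.
split; first exact: power_weight_A1_bound.
move=> c' [c'1 H].
have c'0 : 0 < c' by exact: lt_le_trans c'1.
have nJ : nondegenerate_interval J.
  by split; [exact: interval_is_interval|rewrite leb_itv// lte_fin subr_gt0].
have bpos : 0 < b - a by rewrite subr_gt0.
have := H J nJ (@subset_refl _ _).
rewrite {1}/J (average_itv ab (integral_power_weight _ _ ci0 (lexx a) ab)).
rewrite subrr powR0 ?gt_eqF// subr0 invrK.
have -> : (b - a) `^ c^-1 * c / (b - a) = c * (b - a) `^ (c^-1 - 1).
  by rewrite -(mulr_powRB1 (ltW bpos) ci0); field; rewrite gt_eqF.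
move=> HJ.
have le_y y : a < y -> y < b -> c * (b - a) `^ (c^-1 - 1) <= c' * (y - a) `^ (c^-1 - 1).
  move=> ay yb.
  have yE : (y - a) `^ (c^-1 - 1) = phi y by rewrite /phi /power_weight ay.
  have sub : `]y, b[%classic `<=` J.
    apply: (@subset_trans _ `]a, b[%classic); last exact: subset_itvW.
    by apply: subset_itvr; rewrite bnd_simp ltW.
  have y0 : (0 < leb R `]y, b[%classic)%E by rewrite leb_itv// lte_fin subr_gt0.
  have [] := @ess_inf_onP R J `]y, b[%classic phi _ _ sub y0 (lexx _).
    exact: measurable_line.
  move=> x /=; rewrite in_itv/= => /andP[yx xb] ex.
  rewrite -lee_fin yE; apply: (le_trans HJ); rewrite EFinM.
  apply: lee_wpmul2l; first by rewrite lee_fin ltW.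
  by apply: (le_trans ex); rewrite lee_fin; apply: power_weight_nincr => //; exact: ltW.
rewrite leNgt; apply/negP => c'c.
have cc : c' * (b - a) `^ (c^-1 - 1) < c * (b - a) `^ (c^-1 - 1).
  by rewrite ltr_pM2r// powR_gt0.
have cv : c' * (y - a) `^ (c^-1 - 1) @[y --> b^'-] --> c' * (b - a) `^ (c^-1 - 1).
  apply: cvgM; first exact: cvg_cst.
  exact/cvg_at_left_filter/continuous_shifted_powR.
near b^'- => y.
have ay : a < y by near: y; exact: nbhs_left_gt.
have yb : y < b by near: y; exact: nbhs_left_lt.
suff yc : c' * (y - a) `^ (c^-1 - 1) < c * (b - a) `^ (c^-1 - 1).
  by have := le_y y ay yb; rewrite leNgt yc.
by near: y; exact: cvgr_lt cv _ cc.
Unshelve. all: by end_near. Qed.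

Lemma power_weight_average_power (p : R) : 0 < c + p - p * c -> 0 < p ->
  average J (fun x => (phi x `^ p)%R) =
    ((sharp_constant c p)%:E * average J phi `^ p)%E /\
  (0 < average J phi `^ p < +oo)%E.
Proof.
move=> cp p0.
have bpos : 0 < b - a by rewrite subr_gt0.
rewrite (average_itv ab (integral_power_weight _ _ ci0 (lexx a) ab)).
pose q := (c + p - p * c) / c.
have q0 : 0 < q by rewrite divr_gt0.
have qE : (c^-1 - 1) * p = q - 1 by rewrite /q; field; rewrite gt_eqF.
have -> : average J (fun x => (phi x `^ p)%R) = ((b - a) `^ q / q / (b - a))%:E.
  apply: average_itv => //.
  under eq_integral do rewrite power_weightX qE.
  by rewrite integral_power_weight// subrr powR0 ?subr0// gt_eqF.
rewrite subrr [0 `^ _]powR0 ?gt_eqF// subr0 invrK poweR_EFin; split; last first.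
  by rewrite ltry andbT lte_fin powR_gt0// divr_gt0// mulr_gt0// powR_gt0.
rewrite -EFinM /sharp_constant; congr EFin.
rewrite -(mulr_powRB1 (ltW bpos) ci0) -(mulr_powRB1 (ltW bpos) q0).
have -> : (b - a) * (b - a) `^ (c^-1 - 1) * c / (b - a) = (b - a) `^ (c^-1 - 1) * c.
  by field; rewrite gt_eqF.
rewrite powRM ?powR_ge0 ?(ltW c0)// -powRrM qE -(mulr_powRB1 (ltW c0) p0) /q.
by field; rewrite !gt_eqF// powR_gt0.
Qed.
End extremal_weight.

Theorem theorem2 (R : realType) (J : set R) (c : R)
  (hJ : nondegenerate_interval J) (bJ : bounded_set J) (hc : 1 <= c) :
  (forall phi : R -> R, A1_with_constant J c phi ->
    (forall p : R, admissible_exponent c p -> Lp_on J p phi) /\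
    (forall (I : set R) (p : R),
      nondegenerate_interval I -> I `<=` J -> admissible_exponent c p ->
      (average I (fun x => (phi x `^ p)%R) <=
         (sharp_constant c p)%:E * average I phi `^ p)%E)) /\
  (forall p : R, admissible_exponent c p ->
    forall K : R, K < sharp_constant c p ->
    ~ (forall (phi : R -> R) (I : set R),
        A1_with_constant J c phi ->
        nondegenerate_interval I -> I `<=` J ->
        (average I (fun x => (phi x `^ p)%R) <= K%:E * average I phi `^ p)%E)).
Proof.
have Joo := bounded_leb_lty bJ.
split=> [phi [[mphi phi0 _] [Hc _]]|p ap K Kp HK].
  split=> [p ap|I p nI IJ ap].
    exact: A1_Lp_on Joo mphi phi0 Hc ap.1 (admissible_exponent_gt0 hc ap).
  apply: A1_power_average => //.
  - by apply: le_lt_trans Joo; exact: le_outer_measure.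
  - exact: measurable_funS (interval_measurable_line hJ.1) IJ mphi.
  - by move=> x /IJ /phi0.
  - exact: A1_boundS Hc.
  - exact: ap.1.
  - exact: admissible_exponent_gt0.
have [a [b [b0 [b1 [ab JE]]]]] := nondegenerate_itv hJ Joo.
have wA1 := power_weight_A1_with_constant b0 b1 ab hc.
have [wE /andP[w0 woo]] := power_weight_average_power b0 b1 ab hc
  (admissible_exponent_gt0 hc ap) (lt_le_trans ltr01 ap.1).
rewrite -JE in wA1 wE w0 woo.
have := HK _ J wA1 hJ (@subset_refl _ _).
rewrite wE -(fineK (_ : average J _ `^ p \is a fin_num)%E); last first.
  by rewrite ge0_fin_numE// ltW.
rewrite -!EFinM lee_fin ler_pM2r; last by rewrite fine_gt0// w0.
by rewrite leNgt Kp.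
Qed.
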